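(* Let $R$ be a right Artinian ring which is a maximal subring of a ring $T$. Then $(R:T)_l$ and $(R:T)_r$ are maximal ideals of $R$. Moreover $T/R$, as a right $R/(R:T)_l$-module (resp. as a left $R/(R:T)_r$-module), is isotypic semisimple (and therefore has a maximal submodule). In particular, if $R$ is a right Artinian local ring which is a maximal subring of a ring $T$, then $(R:T)=(R:T)_l=(R:T)_r$.
   Context: All rings are associative, unital with $1\neq 0$, and not necessarily commutative; subrings contain the identity of the overring; modules are unital. A subring $R\subsetneq T$ is a maximal subring of $T$ if there is no subring $S$ with $R\subsetneq S\subsetneq T$. $(R:T):=\{x\in T\mid TxT\subseteq R\}$, $(R:T)_l:=\{x\in T\mid Tx\subseteq R\}$ and $(R:T)_r:=\{x\in T\mid xT\subseteq R\}$ are respectively the largest two-sided, left and right ideal of $T$ contained in $R$; all are two-sided ideals of $R$. The right $R$-module $T/R$ is annihilated by $(R:T)_l$ and the left $R$-module $T/R$ is annihilated by $(R:T)_r$. A module is isotypic semisimple if it is a direct sum of pairwise isomorphic simple modules. *)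

(* Defs.v *)
From HB Require Import structures.
From mathcomp Require Import all_boot all_order all_algebra.
From mathcomp Require Import boolp.

Set Implicit Arguments.
Unset Strict Implicit.
Unset Printing Implicit Defensive.

Import GRing.Theory.
Local Open Scope ring_scope.
Local Open Scope quotient_scope.

(* Subsets are boolean predicates throughout. Since [boolp] is classical, every *)
(* subset is of this form; `[< P >] is the boolean value of a proposition [P]. *)

Section Ideals.
Variable A : nzRingType.
Implicit Types I J : {pred A}.

Definition right_ideal I :=
  zmod_closed I /\ (forall x a, x \in I -> x * a \in I).

Definition two_sided_ideal I :=
  [/\ zmod_closed I, forall a x, x \in I -> a * x \in I
    & forall x a, x \in I -> x * a \in I].

Definition maximal_among (P : {pred A} -> Prop) I :=
  [/\ P I, 1 \notin I
    & forall J, P J -> {subset I <= J} -> 1 \notin J -> J =i I].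

Definition maximal_ideal := maximal_among two_sided_ideal.
Definition maximal_right_ideal := maximal_among right_ideal.

Definition right_artinian :=
  forall I : nat -> {pred A},
    (forall n, right_ideal (I n)) ->
    (forall n, {subset I n.+1 <= I n}) ->
    exists n, forall m, (n <= m)%N -> I m =i I n.

(* Local in the noncommutative sense. A ring has a unique maximal right ideal *)
(* iff it has a unique maximal left ideal. *)
Definition local_ring :=
  exists2 M, maximal_right_ideal M & forall N, maximal_right_ideal N -> N =i M.

End Ideals.

(* A right [A]-module is an [lmodType] over the converse ring [A^c]. *)

Section Modules.
Variable A : pzRingType.

Definition simple_module (M : lmodType A) :=
  (exists x : M, x != 0) /\
  (forall N : {pred M}, submod_closed N ->
     (forall x, x \in N -> x = 0) \/ (forall x, x \in N)).

Definition module_iso (M N : lmodType A) :=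
  exists f : {linear M -> N}, bijective f.

(* The map from the external direct sum of the [N i] to [M] induced by the *)
(* [iota i] is surjective and injective. *)
Definition is_direct_sum (M : lmodType A) (I : eqType) (N : I -> lmodType A)
    (iota : forall i, {linear N i -> M}) :=
  (forall m : M, exists s : seq I, exists f : forall i, N i,
     uniq s /\ m = \sum_(i <- s) iota i (f i)) /\
  (forall (s : seq I) (f : forall i, N i), uniq s ->
     \sum_(i <- s) iota i (f i) = 0 -> forall i, i \in s -> f i = 0).

Definition isotypic_semisimple (M : lmodType A) :=
  exists (I : eqType) (N : I -> lmodType A) (iota : forall i, {linear N i -> M}),
    [/\ forall i, simple_module (N i), forall i j, module_iso (N i) (N j)
      & is_direct_sum iota].

Definition maximal_submodule (M : lmodType A) (N : {pred M}) :=
  [/\ submod_closed N, exists x, x \notin N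
    & forall N' : {pred M}, submod_closed N' -> {subset N <= N'} ->
        N' =i N \/ (forall x, x \in N')].

End Modules.

(* [Quotient.quot] is a ring in the library only over a commutative base. *)
HB.mixin Record isTwoSided (A : nzRingType) (I : A -> bool) := {
  two_sided_mull : forall a x, x \in I -> a * x \in I;
  two_sided_mulr : forall x a, x \in I -> x * a \in I
}.

#[short(type="twoSidedIdeal")]
HB.structure Definition TwoSidedIdeal (A : nzRingType) :=
  {I of GRing.ZmodClosed A I & isTwoSided A I}.

Definition ring_quot (A : nzRingType) (I : twoSidedIdeal A) : Type :=
  Quotient.quot I.

Section RingQuot.
Variables (A : nzRingType) (I : twoSidedIdeal A).

HB.instance Definition _ := GRing.Zmodule.on (ring_quot I).

Definition rq_pi (a : A) : ring_quot I := \pi_(Quotient.quot I) a.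
Definition rq_repr (q : ring_quot I) : A := repr (q : Quotient.quot I).
Definition rq_one : ring_quot I := rq_pi 1.
Definition rq_mul (p q : ring_quot I) : ring_quot I :=
  rq_pi (rq_repr p * rq_repr q).

Lemma rq_reprK q : rq_pi (rq_repr q) = q.
Proof. exact: reprK. Qed.

Lemma rq_eqP a b : rq_pi a = rq_pi b <-> a - b \in I.
Proof. by rewrite /rq_pi Quotient.idealrBE; split=> /eqP. Qed.

Lemma rq_repr_pi a : rq_repr (rq_pi a) - a \in I.
Proof. by apply/rq_eqP; rewrite rq_reprK. Qed.

Lemma rq_piD a b : rq_pi (a + b) = rq_pi a + rq_pi b.
Proof. exact: Quotient.pi_add. Qed.

Lemma rq_piM a b : rq_mul (rq_pi a) (rq_pi b) = rq_pi (a * b).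
Proof.
apply/rq_eqP; set a' := rq_repr _; set b' := rq_repr _.
have -> : a' * b' - a * b = (a' - a) * b' + a * (b' - b).
  by rewrite mulrBl mulrBr addrA subrK.
by apply: rpredD; [apply: two_sided_mulr | apply: two_sided_mull];
  apply: rq_repr_pi.
Qed.

Lemma rq_mulA : associative rq_mul.
Proof.
move=> x y z; rewrite -[x]rq_reprK -[y]rq_reprK -[z]rq_reprK.
by rewrite !rq_piM mulrA.
Qed.

Lemma rq_mul1 : left_id rq_one rq_mul.
Proof. by move=> x; rewrite -[x]rq_reprK rq_piM mul1r. Qed.

Lemma rq_mulr1 : right_id rq_one rq_mul.
Proof. by move=> x; rewrite -[x]rq_reprK rq_piM mulr1. Qed.

Lemma rq_mulDl : left_distributive rq_mul +%R.
Proof.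
move=> x y z; rewrite -[x]rq_reprK -[y]rq_reprK -[z]rq_reprK.
by rewrite -rq_piD !rq_piM -rq_piD mulrDl.
Qed.

Lemma rq_mulDr : right_distributive rq_mul +%R.
Proof.
move=> x y z; rewrite -[x]rq_reprK -[y]rq_reprK -[z]rq_reprK.
by rewrite -rq_piD !rq_piM -rq_piD mulrDr.
Qed.

(* Possibly the zero ring, as [I] is not assumed proper. *)
HB.instance Definition _ := GRing.Zmodule_isPzRing.Build (ring_quot I)
  rq_mulA rq_mul1 rq_mulr1 rq_mulDl rq_mulDr.

End RingQuot.

Definition maximal_subring (T : nzRingType) (R : {pred T}) :=
  [/\ subring_closed R, exists x, x \notin R
    & forall S : {pred T}, subring_closed S -> {subset R <= S} ->
        S =i R \/ (forall x, x \in S)].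

Definition subring_type (T : nzRingType) (R : subringClosed T) : Type :=
  {x : T | x \in R}.

Section SubringType.
Variables (T : nzRingType) (R : subringClosed T).
HB.instance Definition _ := SubChoice.on (subring_type R).
HB.instance Definition _ :=
  [SubChoice_isSubNzRing of subring_type R by <:].
End SubringType.

Section Conductors.
Variables (T : nzRingType) (R : subringClosed T).

(* (R:T), (R:T)_l and (R:T)_r. *)
Definition conductor : {pred T} :=
  [pred x | `[< forall t u, t * x * u \in R >]].
Definition conductor_l : {pred T} := [pred x | `[< forall t, t * x \in R >]].
Definition conductor_r : {pred T} := [pred x | `[< forall t, x * t \in R >]].

(* The same sets, as subsets of the ring [subring_type R]. *)
Definition conductor_l_in (x : subring_type R) : bool := val x \in conductor_l.
Definition conductor_r_in (x : subring_type R) : bool := val x \in conductor_r.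

Lemma conductor_l_inP x :
  reflect (forall t, t * val x \in R) (x \in conductor_l_in).
Proof. exact: asboolP. Qed.

Lemma conductor_r_inP x :
  reflect (forall t, val x * t \in R) (x \in conductor_r_in).
Proof. exact: asboolP. Qed.

Lemma conductor_l_in_zmod : zmod_closed conductor_l_in.
Proof.
split=> [|x y /conductor_l_inP xP /conductor_l_inP yP];
  apply/conductor_l_inP => t; first by rewrite raddf0 mulr0 rpred0.
by rewrite raddfB mulrBr rpredB.
Qed.

Lemma conductor_r_in_zmod : zmod_closed conductor_r_in.
Proof.
split=> [|x y /conductor_r_inP xP /conductor_r_inP yP];
  apply/conductor_r_inP => t; first by rewrite raddf0 mul0r rpred0.
by rewrite raddfB mulrBl rpredB.
Qed.

Lemma conductor_l_in_mull a x :
  x \in conductor_l_in -> a * x \in conductor_l_in.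
Proof.
by move=> /conductor_l_inP xP; apply/conductor_l_inP => t; rewrite rmorphM mulrA.
Qed.

Lemma conductor_l_in_mulr x a :
  x \in conductor_l_in -> x * a \in conductor_l_in.
Proof.
move=> /conductor_l_inP xP; apply/conductor_l_inP => t.
by rewrite rmorphM mulrA rpredM // (valP a).
Qed.

Lemma conductor_r_in_mull a x :
  x \in conductor_r_in -> a * x \in conductor_r_in.
Proof.
move=> /conductor_r_inP xP; apply/conductor_r_inP => t.
by rewrite rmorphM -mulrA rpredM // (valP a).
Qed.

Lemma conductor_r_in_mulr x a :
  x \in conductor_r_in -> x * a \in conductor_r_in.
Proof.
by move=> /conductor_r_inP xP; apply/conductor_r_inP => t; rewrite rmorphM -mulrA.
Qed.

HB.instance Definition _ :=
  GRing.isZmodClosed.Build _ conductor_l_in conductor_l_in_zmod.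
HB.instance Definition _ :=
  isTwoSided.Build _ conductor_l_in conductor_l_in_mull conductor_l_in_mulr.
HB.instance Definition _ :=
  GRing.isZmodClosed.Build _ conductor_r_in conductor_r_in_zmod.
HB.instance Definition _ :=
  isTwoSided.Build _ conductor_r_in conductor_r_in_mull conductor_r_in_mulr.

Definition conductor_l_ideal : twoSidedIdeal (subring_type R) :=
  TwoSidedIdeal.clone _ conductor_l_in _.
Definition conductor_r_ideal : twoSidedIdeal (subring_type R) :=
  TwoSidedIdeal.clone _ conductor_r_in _.

(* Two names for the group T/R, since a type carries only one module structure. *)
Definition right_quot : Type := Quotient.quot R.
Definition left_quot : Type := Quotient.quot R.

HB.instance Definition _ := GRing.Zmodule.on right_quot.
HB.instance Definition _ := GRing.Zmodule.on left_quot.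

Definition quot_pi (t : T) : Quotient.quot R := \pi_(Quotient.quot R) t.

Lemma quot_reprK (m : Quotient.quot R) : quot_pi (repr m) = m.
Proof. exact: reprK. Qed.

Lemma quot_eqP s t : quot_pi s = quot_pi t <-> s - t \in R.
Proof. by rewrite /quot_pi Quotient.idealrBE; split=> /eqP. Qed.

Lemma quot_repr_pi t : repr (quot_pi t) - t \in R.
Proof. by apply/quot_eqP; rewrite quot_reprK. Qed.

Lemma quot_piD s t : quot_pi (s + t) = quot_pi s + quot_pi t.
Proof. exact: Quotient.pi_add. Qed.

Definition right_scale (a : (ring_quot conductor_l_ideal)^c) (m : right_quot) :
  right_quot := quot_pi (repr (m : Quotient.quot R) * val (rq_repr a)).

Definition left_scale (a : ring_quot conductor_r_ideal) (m : left_quot) :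
  left_quot := quot_pi (val (rq_repr a) * repr (m : Quotient.quot R)).

Lemma right_scale_pi (a : subring_type R) t :
  right_scale (rq_pi conductor_l_ideal a) (quot_pi t) = quot_pi (t * val a).
Proof.
apply/quot_eqP; set a' := rq_repr _; set t' := repr _.
have -> : t' * val a' - t * val a = (t' - t) * val a + t' * val (a' - a).
  by rewrite raddfB mulrBl mulrBr [RHS]addrC addrA subrK.
apply: rpredD; first by rewrite rpredM ?(valP a) // quot_repr_pi.
exact: (conductor_l_inP _ (rq_repr_pi _ _)).
Qed.

Lemma left_scale_pi (a : subring_type R) t :
  left_scale (rq_pi conductor_r_ideal a) (quot_pi t) = quot_pi (val a * t).
Proof.
apply/quot_eqP; set a' := rq_repr _; set t' := repr _.
have -> : val a' * t' - val a * t = val a * (t' - t) + val (a' - a) * t'.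
  by rewrite raddfB mulrBl mulrBr [RHS]addrC addrA subrK.
apply: rpredD; first by rewrite rpredM ?(valP a) // quot_repr_pi.
exact: (conductor_r_inP _ (rq_repr_pi _ _)).
Qed.

Lemma right_scaleE a t :
  right_scale a (quot_pi t) = quot_pi (t * val (rq_repr a)).
Proof. by rewrite -right_scale_pi rq_reprK. Qed.

Lemma right_scaleA a b m :
  right_scale a (right_scale b m) = right_scale (a * b) m.
Proof.
have -> : a * b = rq_pi conductor_l_ideal (rq_repr b * rq_repr a).
  by rewrite -rq_piM !rq_reprK.
by rewrite -[m]quot_reprK right_scale_pi !right_scaleE rmorphM mulrA.
Qed.

Lemma right_scale1 : left_id 1 right_scale.
Proof.
by move=> m; rewrite -[m]quot_reprK right_scale_pi rmorph1 mulr1.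
Qed.

Lemma right_scaleDr : right_distributive right_scale +%R.
Proof.
move=> a m n; rewrite -[m]quot_reprK -[n]quot_reprK -[X in right_scale a X]quot_piD.
by rewrite !right_scaleE mulrDl quot_piD.
Qed.

Lemma right_scaleDl m : {morph right_scale^~ m : a b / a + b}.
Proof.
move=> a b; have -> : a + b = rq_pi conductor_l_ideal (rq_repr a + rq_repr b).
  by rewrite rq_piD !rq_reprK.
by rewrite -[m]quot_reprK right_scale_pi !right_scaleE raddfD mulrDr quot_piD.
Qed.

HB.instance Definition _ :=
  GRing.Zmodule_isLmodule.Build (ring_quot conductor_l_ideal)^c right_quot
    right_scaleA right_scale1 right_scaleDr right_scaleDl.

Lemma left_scaleE a t :
  left_scale a (quot_pi t) = quot_pi (val (rq_repr a) * t).
Proof. by rewrite -left_scale_pi rq_reprK. Qed.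

Lemma left_scaleA a b m : left_scale a (left_scale b m) = left_scale (a * b) m.
Proof.
have -> : a * b = rq_pi conductor_r_ideal (rq_repr a * rq_repr b).
  by rewrite -rq_piM !rq_reprK.
by rewrite -[m]quot_reprK left_scale_pi !left_scaleE rmorphM mulrA.
Qed.

Lemma left_scale1 : left_id 1 left_scale.
Proof. by move=> m; rewrite -[m]quot_reprK left_scale_pi rmorph1 mul1r. Qed.

Lemma left_scaleDr : right_distributive left_scale +%R.
Proof.
move=> a m n; rewrite -[m]quot_reprK -[n]quot_reprK -[X in left_scale a X]quot_piD.
by rewrite !left_scaleE mulrDr quot_piD.
Qed.

Lemma left_scaleDl m : {morph left_scale^~ m : a b / a + b}.
Proof.
move=> a b; have -> : a + b = rq_pi conductor_r_ideal (rq_repr a + rq_repr b).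
  by rewrite rq_piD !rq_reprK.
by rewrite -[m]quot_reprK left_scale_pi !left_scaleE raddfD mulrDl quot_piD.
Qed.

HB.instance Definition _ :=
  GRing.Zmodule_isLmodule.Build (ring_quot conductor_r_ideal) left_quot
    left_scaleA left_scale1 left_scaleDr left_scaleDl.

End Conductors.

Arguments conductor_l_in {T} R.
Arguments conductor_r_in {T} R.

(* Main.v *)
Require Import Defs.
From HB Require Import structures.
From mathcomp Require Import all_boot all_order all_algebra.
From mathcomp Require Import boolp classical_sets.

(** Let P = (R:T)_l and Q = (R:T)_r. Both are prime ideals of R. For P: if
a R b lies in P, the set K of the x in T with T x R b contained in R is a
(T, R)-subbimodule of T containing T a, so R + K is a subring. If a is not in
P then K is not contained in R, whence R + K = T by maximality, and
T b = R b + K b lies in R, that is, b is in P. The argument for Q is symmetric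
([conductor_l_prime], [conductor_r_prime]).

A right Artinian prime ring S, such as R/P or R/Q, has a nonzero idempotent e
for which e S and S e are simple and S e S = S ([ex_full_primitive]): by
Brauer's lemma a minimal right ideal is generated by such an idempotent e,
primeness makes S e simple as well, and orthogonalising idempotents of the
ideal S e S shows that it contains 1. A nonzero ideal of S then contains e and
hence 1, so S is simple; this gives the maximality of P and Q. If moreover R
has only one maximal right ideal M, then for each s with e s outside P the
elements x with e s x in P form a maximal right ideal, which must be M; so
e R M lies in P and P = M. In the same way Q = M, so P = Q is a two-sided ideal
of T and equals (R:T).

A left S-module V equals S e V, and each nonzero element of e V generates a
copy of S e. A maximal subset of e V that is independent over the division
ring e S e exhibits V as a direct sum of copies of S e
([full_primitive_isotypic]). If V is nonzero, a submodule maximal among those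
that avoid a fixed nonzero element m of e V is a maximal submodule, because m
generates e V modulo it ([ex_maximal_submodule]). Neither statement assumes a
chain condition, and both are left-right neutral: they apply to left
R/Q-modules and, over the converse ring, to right R/P-modules. *)

Set Implicit Arguments.
Unset Strict Implicit.
Unset Printing Implicit Defensive.

Import GRing.Theory.
Local Open Scope ring_scope.

(** * Primitive idempotents of prime rings *)

Section PrimeRing.
Variable A : pzRingType.
Implicit Types (a b e s x y : A).

(** A nonzero ring in which a A b = 0 only if a = 0 or b = 0. *)
Definition prime_ring :=
  (1 : A) != 0 /\
  forall a b, (forall s, a * s * b = 0) -> a = 0 \/ b = 0.

(** The descending chain condition on principal right ideals. *)
Definition dcc_principal_right :=
  forall x : nat -> A, (forall n, exists a, x n.+1 = x n * a) ->
    exists n a, x n = x n.+1 * a.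

(** For e a nonzero idempotent, this says that A e is a simple left module. *)
Definition left_primitive e := forall x, x * e != 0 -> exists y, y * (x * e) = e.

(** For e a nonzero idempotent, this says that e A is a simple right module. *)
Definition right_primitive e :=
  forall x, e * x != 0 -> exists y, e * x * y = e.

(** A e A = A, stated without finite sums: every two-sided ideal J containing e
contains 1. *)
Definition full e :=
  forall J : A -> Prop, J 0 -> (forall x y, J x -> J y -> J (x - y)) ->
    (forall a x, J x -> J (a * x)) -> (forall x a, J x -> J (x * a)) ->
    J e -> J 1.

Lemma dcc_minimal (Pr : A -> Prop) x0 :
  dcc_principal_right -> Pr x0 ->
  exists2 x, Pr x &
    forall y, Pr y -> (exists a, y = x * a) -> exists a, x = y * a.
Proof.
move=> dcc Px0; apply: contrapT => noMin.
have step (u : {x | Pr x}) : exists v : {x | Pr x},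
    (exists a, sval v = sval u * a) /\ ~ exists a, sval u = sval v * a.
  case: u => x Px /=; apply: contrapT => noStep; apply: noMin; exists x => // y Py yx.
  by apply: contrapT => xy; apply: noStep; exists (exist _ y Py).
have [f fP] := choice step.
have [n|n xn] := dcc (fun n => sval (iter n f (exist _ x0 Px0))).
  exact: (proj1 (fP _)).
exact: (proj2 (fP _) xn).
Qed.

Hypotheses (primeA : prime_ring) (dccA : dcc_principal_right).

Lemma primeP a b : a != 0 -> b != 0 -> exists s, a * s * b != 0.
Proof.
move=> a0 b0; apply: contrapT => no.
by have [s||] := primeA.2 a b;
  [apply: contrapT => /eqP n; apply: no; exists s | apply/eqP..].
Qed.

(** Brauer's lemma: a minimal right ideal x A with x A x nonzero is generated by
an idempotent. *)
Lemma ex_right_primitive : exists e, [/\ e != 0, e * e = e & right_primitive e].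
Proof.
have [x x0 xmin] := @dcc_minimal (fun x => x != 0) 1 dccA primeA.1.
have gen y a : y = x * a -> y != 0 -> exists b, x = y * b.
  by move=> yE y0; apply: xmin => //; exists a.
have [s xsx] := primeP x0 x0.
have [t xE] : exists t, x = x * s * x * t by apply: (gen _ (s * x)); rewrite ?mulrA.
pose e := x * t * s.
have ae : x * s * e = x * s by rewrite /e !mulrA -xE.
(* Otherwise e e - e, which x s kills, would generate x A, and x s x would be 0. *)
have ee : e * e = e.
  apply/eqP; rewrite -subr_eq0; apply: contraNT xsx => n0.
  have [b xb] : exists b, x = (e * e - e) * b.
    by apply: (gen _ (t * s * e - t * s)) => //; rewrite mulrBr !mulrA.
  by rewrite {2}xb mulrA mulrBr mulrA !ae subrr mul0r.
have e0 : e != 0 by apply: contraNneq xsx => e0; rewrite -ae e0 mulr0 mul0r.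
exists e; split=> // y ey0.
have [b xb] : exists b, x = e * y * b by apply: (gen _ (t * s * y)); rewrite ?mulrA.
by exists (b * t * s); rewrite !mulrA -xb.
Qed.

Lemma right_primitive_left e :
  e != 0 -> e * e = e -> right_primitive e -> left_primitive e.
Proof.
move=> e0 ee rp y ye0; have [s] := primeP e0 ye0.
have [u uE] : exists u, u = e * s * (y * e) by eexists.
have eu : e * u = u by rewrite uE !mulrA ee.
have ue : u * e = u by rewrite uE -!mulrA ee.
rewrite -uE => u0; have [z uz] : exists z, u * z = e.
  by have [|z uz] := rp u; [rewrite eu | exists z; rewrite -[in LHS]eu].
have [w zw] : exists w, e * (z * e) * w = e.
  apply: rp; apply: contraNneq e0 => eze; apply/eqP.
  have: u * (e * (z * e)) = 0 by rewrite eze mulr0.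
  by rewrite !mulrA ue uz ee.
have uw : e * w = u by rewrite -[RHS]ue -{2}zw !mulrA ue uz ee.
(* The element e z e inverts u = e s y e on both sides in the corner e A e. *)
exists (e * z * (e * s)); rewrite -[LHS]mulrA -uE -uw -[RHS]zw.
by rewrite !mulrA.
Qed.

(** The argument is the orthogonalisation of idempotents: among the right
ideals (1 - f) A, with f an idempotent of the ideal generated by e, a minimal
one is zero. *)
Lemma primitive_full e :
  e != 0 -> e * e = e -> left_primitive e -> full e.
Proof.
move=> e0 ee lp J J0 JB Jl Jr Je.
have JD x y : J x -> J y -> J (x + y).
  by move=> Jx Jy; rewrite -[y]opprK; apply: (JB) => //; rewrite -sub0r; apply: JB.
have [|h] := @dcc_minimal (fun h => exists f, [/\ h = 1 - f, f * f = f & J f]) 1 dccA.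
  by exists 0; rewrite subr0 mul0r.
case=> f [hE ff Jf] hmin.
have hh : h * h = h.
  by rewrite hE mulrBr mulr1 mulrBl mul1r ff subrr subr0.
have [h0|h0] := eqVneq h 0.
  by move/eqP: hE; rewrite h0 eq_sym subr_eq0 => /eqP ->.
have [t hte] := primeP h0 e0.
have [s est] : exists s, s * (h * t * e) = e by apply: lp.
have [u uE] : exists u, u = h * t * e by eexists.
have [v vE] : exists v, v = s * h by eexists.
have hu : h * u = u by rewrite uE !mulrA hh.
have ue : u * e = u by rewrite uE -!mulrA ee.
have vh : v * h = v by rewrite vE -mulrA hh.
have vu : v * u = e by rewrite vE -mulrA hu uE.
(* g is a nonzero idempotent of A e A below h, so h - g is smaller than h. *)
have [g gE] : exists g, g = u * v by eexists.
have hg : h * g = g by rewrite gE mulrA hu.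
have gh : g * h = g by rewrite gE -mulrA vh.
have gg : g * g = g by rewrite gE mulrA -[u * v * u]mulrA vu ue.
have g0 : g != 0.
  apply: contraNneq e0 => g0; have: v * g * u = 0 by rewrite g0 mulr0 mul0r.
  by rewrite gE -mulrA -mulrA vu mulrA vu ee => ->.
have Jg : J g by rewrite gE -ue -mulrA; apply/Jl/Jr.
have [||a ha] := hmin (h - g).
- exists (f + g); split; last exact: JD.
    by rewrite hE opprD addrA.
  have fE : f = 1 - h by rewrite hE opprB addrC subrK.
  rewrite mulrDl !mulrDr ff gg fE mulrBl mulrBr mul1r mulr1 hg gh.
  by rewrite subrr addr0 add0r.
- by exists (1 - g); rewrite mulrBr mulr1 hg.
have: g * h = 0 by rewrite ha mulrA mulrBr gh gg subrr mul0r.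
by rewrite gh => g00; rewrite g00 eqxx in g0.
Qed.

Lemma ex_full_primitive :
  exists e, [/\ e != 0, e * e = e, left_primitive e, right_primitive e & full e].
Proof.
have [e [e0 ee rp]] := ex_right_primitive; exists e.
by have lp := right_primitive_left e0 ee rp; split=> //; apply: primitive_full.
Qed.

End PrimeRing.

(** A nonzero two-sided ideal J of a prime ring with the descending chain
condition contains 1. *)
Lemma prime_dcc_simple (A : pzRingType) (J : A -> Prop) x :
  prime_ring A -> dcc_principal_right A ->
  J 0 -> (forall x y, J x -> J y -> J (x - y)) ->
  (forall a x, J x -> J (a * x)) -> (forall x a, J x -> J (x * a)) ->
  J x -> x != 0 -> J 1.
Proof.
move=> pA dA J0 JB Jl Jr Jx x0.
have [e [e0 ee lp rp fe]] := ex_full_primitive pA dA.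
apply: fe => //; have [s esx] := primeP pA e0 x0.
by have [|y <-] := rp (s * x); rewrite mulrA //; apply/Jr/Jl.
Qed.

(** * Modules over a ring with a full primitive idempotent *)

(** The left ideal A e, for e idempotent, described as the set of the x with
x e = x. *)
Definition left_principal (A : pzRingType) (e : A) : {pred A^o} :=
  [pred x : A | x * e == x].

Section LeftPrincipal.
Variables (A : pzRingType) (e : A).

Lemma left_principal_submod : submod_closed (left_principal e).
Proof.
split=> [|a x y]; first by rewrite inE mul0r.
rewrite !inE => /eqP xe /eqP ye; apply/eqP.
by rewrite mulrDl ye; congr (_ + _); rewrite -[in RHS]xe; apply/esym/mulrA.
Qed.

HB.instance Definition _ :=
  GRing.isSubmodClosed.Build A A^o (left_principal e) left_principal_submod.

Definition left_principal_type : Type := {x : A^o | x \in left_principal e}.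
HB.instance Definition _ := SubChoice.on left_principal_type.
HB.instance Definition _ :=
  [SubChoice_isSubLmodule of left_principal_type by <:].

Lemma left_principal_eval_linear (M : lmodType A) (m : M) :
  linear (fun x : left_principal_type => (val x : A) *: m).
Proof.
move=> a x y; have -> : val (a *: x + y) = a * val x + val y :> A by [].
by rewrite scalerDl scalerA.
Qed.

(** The map x |-> x m from A e to M. *)
Definition left_principal_eval (M : lmodType A) (m : M)
  (x : left_principal_type) : M := (val x : A) *: m.

HB.instance Definition _ (M : lmodType A) (m : M) :=
  GRing.isLinear.Build A left_principal_type M *:%R (left_principal_eval m)
    (left_principal_eval_linear m).

Hypotheses (e_neq0 : e != 0) (ee : e * e = e) (lp_e : left_primitive e).

Lemma left_principal_simple : simple_module left_principal_type.
Proof.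
split=> [|N [N0 Nlin]].
  have eP : (e : A^o) \in left_principal e by rewrite inE ee.
  by exists (Sub e eP); rewrite -val_eqE.
have [N1|] := pselect (forall x, x \in N -> x = 0); first by left.
move/existsNP => [x /not_implyP[xN /eqP x0]]; right=> y.
have xe : (val x : A) * e = val x by apply/eqP/(valP x).
have ye : (val y : A) * e = val y by apply/eqP/(valP y).
have [|a axe] := lp_e (x := val x); first by rewrite xe -[0]/(val (0 : left_principal_type)) val_eqE.
have -> : y = (val y * a) *: x + 0.
  apply: val_inj; rewrite addr0 -[RHS]/((val y * a) * val x :> A).
  by rewrite -mulrA -[val x]xe axe ye.
exact: Nlin.
Qed.

End LeftPrincipal.

Section Modules.
Variables (A : pzRingType) (e : A) (M : lmodType A).
Hypotheses (e_neq0 : e != 0) (ee : e * e = e).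
Hypotheses (lp_e : left_primitive e) (full_e : full e).

(** A submodule of M containing e M is M, as the elements of A that map M into
it form a two-sided ideal. *)
Lemma full_submodule (N : M -> Prop) :
  N 0 -> (forall a x y, N x -> N y -> N (a *: x + y)) ->
  (forall x, N (e *: x)) -> forall x, N x.
Proof.
move=> N0 Nlin Ne x; rewrite -[x]scale1r; move: x.
apply: (full_e (J := fun a => forall x, N (a *: x))) => //.
- by move=> x; rewrite scale0r.
- by move=> a b Na Nb x; rewrite scalerBl addrC -scaleN1r; apply: Nlin.
- by move=> a b Nb x; rewrite -scalerA -[_ *: _]addr0; apply: Nlin.
- by move=> a b Na x; rewrite -scalerA.
Qed.

(** A submodule X maximal among those that avoid a nonzero m in e M is a maximal
submodule. *)
Lemma ex_maximal_submodule (m0 : M) :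
  m0 != 0 -> exists N : {pred M}, maximal_submodule N.
Proof.
move=> m0_neq0.
have [m m_neq0 em] : exists2 m : M, m != 0 & e *: m = m.
  apply: contrapT => no; case/eqP: m0_neq0.
  apply: (full_submodule (N := fun x => x = 0)) => // [a x y -> ->|x].
    by rewrite scaler0 addr0.
  apply: contrapT => /eqP ex0; apply: no; exists (e *: x) => //.
  by rewrite scalerA ee.
(* Condition P holds for the empty set, so that it passes to the union of an
   empty chain; a maximal X is a submodule all the same. *)
pose P (X : set M) :=
  (forall a x y, X x -> X y -> X (a *: x + y)) /\ ~ X m.
have [F FP Ftot|X [[Xlin Xm] Xmax]] := @Zorn_bigcup M P.
  split=> [a x y [X FX Xx] [Y FY Yy]|[X FX Xm]]; last exact: (FP X FX).2.
  case: (Ftot _ _ FX FY) => sub.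
    by exists Y => //; apply: (FP Y FY).1 => //; apply: sub.
  by exists X => //; apply: (FP X FX).1 => //; apply: sub.
have max (Y : set M) : (forall a x y, Y x -> Y y -> Y (a *: x + y)) ->
    (X `<=` Y)%classic -> forall y, Y y -> ~ X y -> Y m.
  move=> Ylin XY y Yy Xy; apply: contrapT => Ym; apply: (Xmax Y) => //.
  by split=> // YX; apply/Xy/YX.
have X0 : X 0.
  apply: contrapT => X0; case/eqP: m_neq0.
  apply: (max [set 0]%classic _ _ 0) => //=.
    by move=> a x y -> ->; rewrite scaler0 addr0.
  by move=> x Xx; case: X0; rewrite -[0](addNr x) -scaleN1r; apply: Xlin.
have XZ a x : X x -> X (a *: x) by move=> Xx; rewrite -[_ *: _]addr0; apply: Xlin.
(* m generates e M modulo X. *)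
have gen x : e *: x = x -> exists a, X (x - a *: m).
  move=> ex; have [Xx|Xx] := pselect (X x); first by exists 0; rewrite scale0r subr0.
  have [|z Xz||a Xa] := max [set z | exists a, X (z - a *: x)]%classic _ _ x _ Xx.
  - move=> c y z [a Xa] [b Xb]; exists (c * a + b).
    rewrite scalerDl opprD addrACA -scalerA -scalerN.
    by rewrite -(scalerDr c); apply: Xlin.
  - by exists 0; rewrite scale0r subr0.
  - by exists 1; rewrite scale1r subrr.
  have eXa : X (m - (e * a * e) *: x).
    by rewrite -{1}em -!scalerA ex -scalerBr; apply: XZ.
  have [|y yae] := lp_e (x := e * a).
    by apply: contra_notN Xm => /eqP ae0; rewrite ae0 scale0r subr0 in eXa.
  exists y; have -> : x - y *: m = - 1 *: (y *: (m - (e * a * e) *: x)).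
    by rewrite scalerBr scalerA yae ex scaleN1r opprB.
  by apply/XZ/XZ.
exists (fun x => `[< X x >]); split.
- split=> [|a x y]; first exact/asboolP.
  by move=> /asboolP Xx /asboolP Xy; apply/asboolP/Xlin.
- by exists m; apply/asboolP.
move=> N' [N'0 N'lin] NN'.
have [eqN|/existsNP[y /not_implyP[N'y Xy]]] := pselect (forall y, y \in N' -> X y).
  by left=> y; apply/idP/idP => [/eqN Xy|/NN' //]; apply/asboolP.
right; have N'm : m \in N'.
  apply: (max [set z | z \in N']%classic _ _ y) => //=.
  by move=> u Xu; apply/NN'/asboolP.
apply: (full_submodule (N := fun z => z \in N')) => // u.
have [|a Xa] := gen (e *: u); first by rewrite scalerA ee.
rewrite -[e *: u](subrK (a *: m)) addrC; apply: N'lin => //.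
exact/NN'/asboolP.
Qed.

(** B is a subset of e M, independent in the sense that a finite combination of
elements of B with coefficients in A e vanishes only if its coefficients do. *)
Definition corner_free (B : set M) :=
  (forall b, B b -> e *: b = b) /\
  forall (s : seq M) (c : M -> A), uniq s -> (forall b, b \in s -> B b) ->
    (forall b, c b * e = c b) -> \sum_(b <- s) c b *: b = 0 ->
    forall b, b \in s -> c b = 0.

(** The combinations of finitely many elements of B with coefficients in A e. *)
Definition corner_span (B : set M) (m : M) :=
  exists (s : seq M) (c : M -> A), [/\ uniq s, forall b, b \in s -> B b,
    forall b, c b * e = c b & m = \sum_(b <- s) c b *: b].

Lemma ex_maximal_corner_free :
  exists2 B, corner_free B & forall B', (B `<` B')%classic -> ~ corner_free B'.
Proof.
have [F FP Ftot|B [Bfree Bmax]] := @Zorn_bigcup M corner_free; last by exists B.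
split=> [b [X FX Xb]|s c us sF]; first exact: (FP X FX).1.
have [s0|[X FX sX]] : s = [::] \/ exists2 X, F X & forall b, b \in s -> X b.
  elim: s {us} sF => [|b s IHs] sF; first by left.
  right; have [X FX Xb] := sF b (mem_head b s).
  have [|s0|[Y FY sY]] := IHs.
  - by move=> b' b's; apply: sF; rewrite inE b's orbT.
  - by exists X => // b'; rewrite s0 inE => /eqP ->.
  case: (Ftot _ _ FX FY) => sub.
    by exists Y => // b'; rewrite inE => /predU1P[->|/sY //]; apply: sub.
  by exists X => // b'; rewrite inE => /predU1P[->//|/sY]; apply: sub.
  by move=> _ _ b; rewrite s0.
exact: (FP X FX).2.
Qed.

Lemma corner_span_lin (B : set M) a x y :
  corner_span B x -> corner_span B y -> corner_span B (a *: x + y).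
Proof.
move=> [s [c [us sB ce ->]]] [t [d [ut tB de ->]]].
(* A sum over a part of the union of s and t, extended by zero. *)
have widen (r : seq M) (F : M -> M) : uniq r ->
    {subset r <= undup (s ++ t)} ->
    \sum_(b <- r) F b = \sum_(b <- undup (s ++ t)) if b \in r then F b else 0.
  move=> ur rst; rewrite -big_mkcond -big_filter; apply: perm_big.
  apply: uniq_perm => // [|b]; first by rewrite filter_uniq ?undup_uniq.
  by rewrite mem_filter; case: (boolP (b \in r)) => // /rst ->.
exists (undup (s ++ t)); exists (fun b =>
  (if b \in s then a * c b else 0) + (if b \in t then d b else 0)).
split=> [|b|b|]; first exact: undup_uniq.
- by rewrite mem_undup mem_cat => /orP[/sB|/tB].
- by rewrite mulrDl; case: ifP => _; case: ifP => _; rewrite ?mul0r -?mulrA ?ce ?de.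
rewrite (widen s) // => [|b bs]; last by rewrite mem_undup mem_cat bs.
rewrite (widen t) // => [|b bt]; last by rewrite mem_undup mem_cat bt orbT.
rewrite scaler_sumr -big_split; apply: eq_bigr => b _ /=.
rewrite scalerDl; congr (_ + _); case: ifP => _; rewrite ?scaler0 ?scale0r //.
by rewrite scalerA.
Qed.

Lemma corner_span0 B : corner_span B 0.
Proof.
by exists [::], (fun=> 0); split=> // [b|]; rewrite ?mul0r ?big_nil.
Qed.

Lemma corner_span_sum B (s : seq M) (c : M -> A) :
  uniq s -> (forall b, b \in s -> B b) -> (forall b, c b * e = c b) ->
  corner_span B (\sum_(b <- s) c b *: b).
Proof. by move=> us sB ce; exists s, c. Qed.

Lemma maximal_corner_free_span B :
  corner_free B -> (forall B', (B `<` B')%classic -> ~ corner_free B') ->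
  forall m, corner_span B m.
Proof.
move=> [Be Bfree] Bmax; apply: full_submodule => [|a x y|x].
- exact: corner_span0.
- exact: corner_span_lin.
have: e *: (e *: x) = e *: x by rewrite scalerA ee.
move: (e *: x) => m em.
apply: contrapT => Bm.
have Bm' : ~ B m.
  move=> mB; apply: Bm; exists [:: m], (fun=> e).
  by split=> // [b|]; [rewrite inE => /eqP -> | rewrite big_seq1 em].
apply: (Bmax (B `|` [set m])%classic); first split.
- by move=> b Bb; left.
- by move=> sub; apply/Bm'/sub; right.
split=> [b [/Be //|-> //]|s c us sB ce s0 b bs].
have [ms|ms] := boolP (m \in s); last first.
  apply: (Bfree s c) => // b' b's; case: (sB _ b's) => // b'm.
  by rewrite -b'm b's in ms.
have remB b' : b' \in rem m s -> B b'.
  by rewrite mem_rem_uniq // inE => /andP[/eqP b'm /sB[]].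
have ur := rem_uniq m us; move: s0; rewrite (big_rem m) //= => s0.
(* Otherwise m = e m could be solved for and would lie in the span of B. *)
have cm0 : c m = 0.
  apply: contrapT => /eqP cm; apply: Bm; have [|y yc] := lp_e (x := c m).
    by rewrite ce.
  have -> : m = (- y) *: (\sum_(b <- rem m s) c b *: b) + 0.
    rewrite addr0 -[in LHS]em -yc ce -scalerA scaleNr -scalerN; congr (_ *: _).
    by apply/eqP; rewrite -addr_eq0 s0.
  by apply: corner_span_lin; [apply: corner_span_sum | apply: corner_span0].
have [->//|bm] := eqVneq b m.
move: s0; rewrite cm0 scale0r add0r => s0; apply: (Bfree (rem m s) c) => //.
by rewrite mem_rem_uniq // inE bm.
Qed.

(** M is the direct sum of the copies A b of A e, for b in a maximal independent
subset of e M. *)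
Lemma full_primitive_isotypic : isotypic_semisimple M.
Proof.
have [B Bfree Bmax] := ex_maximal_corner_free.
pose I := {b : M | `[< B b >]}.
exists I, (fun=> left_principal_type e),
  (fun i : I => @left_principal_eval A e M (val i)).
split=> [_|_ _|]; first exact: left_principal_simple.
  by exists idfun; exists idfun.
split=> [m|s f us fs0 i si].
  have [s [c [us sB ce ->]]] := maximal_corner_free_span Bfree Bmax m.
  have cP b : (c b : A^o) \in left_principal e by rewrite inE ce.
  exists (pmap insub s), (fun i => Sub (c (val i)) (cP _)); split.
    exact: pmap_sub_uniq.
  have sE : map val (pmap (insub : M -> option I) s) = s.
    rewrite (pmap_filter (insubK _)); apply/all_filterP/allP => b bs.
    by rewrite isSome_insub; apply/asboolP/sB.
  by rewrite -{1}sE big_map.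
(* The coefficients f, extended by zero outside B. *)
pose c b : A := if (insub b : option I) is Some j then val (f j) else 0.
have cval j : c (val j) = val (f j) by rewrite /c valK.
apply: val_inj; rewrite -[LHS](cval i).
apply: (Bfree.2 (map val s) c); last exact: map_f.
- by rewrite map_inj_uniq //; apply: val_inj.
- by move=> b /mapP[j _ ->]; apply/asboolP/(valP j).
- rewrite /c => b; case: insubP => [j _ _|_]; last by rewrite mul0r.
  exact/eqP/(valP (f j)).
by rewrite big_map -[RHS]fs0; apply: eq_bigr => j _; rewrite cval.
Qed.

End Modules.

(** * Quotients by prime ideals *)

(** Proper ideals I such that a A b is contained in I only if a or b is in I. *)
Definition prime_ideal (A : nzRingType) (I : {pred A}) :=
  1 \notin I /\
  forall a b, (forall s, a * s * b \in I) -> a \in I \/ b \in I.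

Section PrimeIdeal.
Variables (A : nzRingType) (I : twoSidedIdeal A).
Local Notation pi := (rq_pi I).

Lemma rq_pi_mul a b : pi (a * b) = pi a * pi b.
Proof. by rewrite -rq_piM. Qed.

Lemma rq_pi0 : pi 0 = 0.
Proof. by apply: (addrI (pi 0)); rewrite -rq_piD !addr0. Qed.

Lemma rq_pi_eq0 a : pi a = 0 <-> a \in I.
Proof. by rewrite -rq_pi0 rq_eqP subr0. Qed.

Lemma prime_ideal_quot : prime_ideal I -> prime_ring (ring_quot I).
Proof.
move=> [I1 Ip]; split=> [|p q].
  by apply: contraNN I1 => /eqP /rq_pi_eq0.
rewrite -[p]rq_reprK -[q]rq_reprK => pq; rewrite !rq_pi_eq0; apply: Ip => s.
by apply/rq_pi_eq0; rewrite !rq_pi_mul.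
Qed.

Lemma right_artinian_quot : right_artinian A -> dcc_principal_right (ring_quot I).
Proof.
move=> art x xS.
pose J n : {pred A} := fun r => `[< exists a, pi r = x n * a >].
have [||n Jn] := art J.
- move=> n; split; first split.
  + by apply/asboolP; exists 0; rewrite rq_pi0 mulr0.
  + move=> r s /asboolP[a ra] /asboolP[b sb]; apply/asboolP; exists (a - b).
    rewrite mulrBr -ra -sb; apply: (addIr (pi s)).
    by rewrite -rq_piD !subrK.
  + move=> r b /asboolP[a ra]; apply/asboolP; exists (a * pi b).
    by rewrite rq_pi_mul ra mulrA.
- move=> n r /asboolP[a ra]; apply/asboolP; have [b xb] := xS n.
  by exists (b * a); rewrite ra xb mulrA.
exists n; have: rq_repr (x n) \in J n.
  by apply/asboolP; exists 1; rewrite mulr1 rq_reprK.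
by rewrite -(Jn n.+1 (leqnSn n)) => /asboolP[a]; rewrite rq_reprK; exists a.
Qed.

(** In a right Artinian ring, prime ideals are maximal. *)
Lemma prime_ideal_maximal :
  right_artinian A -> prime_ideal I -> maximal_ideal I.
Proof.
move=> art Ip; have [I1 _] := Ip; split=> //.
  split=> [|a x|x a]; [|exact: two_sided_mull|exact: two_sided_mulr].
  by split=> [|x y]; [apply: rpred0 | apply: rpredB].
move=> J [[J0 JB] Jl Jr] IJ J1 x.
apply/idP/idP => [Jx|/IJ //]; apply: contraNT J1 => Ix.
have JI y z : pi y = pi z -> y \in J -> z \in J.
  by move=> /rq_eqP/IJ yz Jy; rewrite -[z](subKr y); apply: JB.
(* J is a union of cosets of I, so representatives do not matter. *)
have JK q : (rq_repr (pi q) \in J) = (q \in J).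
  by apply/idP/idP; apply: JI; rewrite rq_reprK.
suff: rq_repr (1 : ring_quot I) \in J by rewrite JK.
apply: (prime_dcc_simple (J := fun q : ring_quot I => rq_repr q \in J) (x := pi x)).
- exact: prime_ideal_quot.
- exact: right_artinian_quot.
- by rewrite -rq_pi0 JK.
- move=> p q Jp Jq; apply: (JI (rq_repr p - rq_repr q)); last exact: JB.
  by rewrite rq_reprK; apply: (addIr q); rewrite -{2}[q]rq_reprK -rq_piD !subrK rq_reprK.
- by move=> p q Jq; rewrite -[p]rq_reprK -[q]rq_reprK -rq_pi_mul JK; apply: Jl.
- by move=> p q Jp; rewrite -[p]rq_reprK -[q]rq_reprK -rq_pi_mul JK; apply: Jr.
- by rewrite JK.
by apply: contraNneq Ix => /rq_pi_eq0.
Qed.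

Lemma prime_ideal_right_module (M : lmodType (ring_quot I)^c) :
  right_artinian A -> prime_ideal I ->
  isotypic_semisimple M /\
  forall m : M, m != 0 -> exists N : {pred M}, maximal_submodule N.
Proof.
move=> art Ip.
have [e [e0 ee lp rp fe]] :=
  ex_full_primitive (prime_ideal_quot Ip) (right_artinian_quot art).
(* Over the converse ring, e A is the left module generated by e. *)
have lp' : @left_primitive (ring_quot I)^c e.
  by move=> x ex; have [y ey] := rp x ex; exists y.
have fe' : @full (ring_quot I)^c e.
  by move=> J J0 JB Jl Jr; apply: (fe J J0 JB) => x y; [apply: Jr | apply: Jl].
split=> [|m]; first exact: (full_primitive_isotypic (A := (ring_quot I)^c) M e0 ee lp' fe').
exact: (ex_maximal_submodule (A := (ring_quot I)^c) ee lp' fe').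
Qed.

Lemma prime_ideal_left_module (M : lmodType (ring_quot I)) :
  right_artinian A -> prime_ideal I ->
  isotypic_semisimple M /\
  forall m : M, m != 0 -> exists N : {pred M}, maximal_submodule N.
Proof.
move=> art Ip.
have [e [e0 ee lp rp fe]] :=
  ex_full_primitive (prime_ideal_quot Ip) (right_artinian_quot art).
by split=> [|m]; [exact: full_primitive_isotypic e0 ee lp fe | exact: (ex_maximal_submodule ee lp fe)].
Qed.

(** For a primitive idempotent e modulo I, the annihilators modulo I of the
elements e s, with e s outside I, are maximal right ideals. If they all equal M,
then e A M lies in I, so M lies in I by primeness. *)
Lemma prime_ideal_local (M : {pred A}) :
  right_artinian A -> prime_ideal I ->
  (forall N : {pred A}, maximal_right_ideal N -> N =i M) -> I =i M.
Proof.
move=> art Ip Muniq.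
have [q [q0 _ _ rp _]] :=
  ex_full_primitive (prime_ideal_quot Ip) (right_artinian_quot art).
have [e eE] : exists e, pi e = q by exists (rq_repr q); rewrite rq_reprK.
pose N s : {pred A} := fun x => e * s * x \in I.
have NE s x : (x \in N s) = (e * s * x \in I) by [].
have Nmax s : e * s \notin I -> N s =i M.
  move=> es; apply: Muniq; split.
  - split; first split.
    + by rewrite NE mulr0 rpred0.
    + by move=> x y; rewrite !NE mulrBr; apply: rpredB.
    + by move=> x a; rewrite !NE mulrA; apply: two_sided_mulr.
  - by rewrite NE mulr1.
  move=> J [[J0 JB] Jr] NJ J1 x; apply/idP/idP => [Jx|/NJ //].
  apply: contraNT J1; rewrite NE => esx.
  have [|z qz] := rp (pi (s * x)).
    by rewrite -eE -rq_pi_mul mulrA; apply: contraNneq esx => /rq_pi_eq0.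
  have N1 : 1 - x * rq_repr z * s \in N s.
    rewrite NE mulrBr mulr1; apply/rq_eqP.
    by rewrite !rq_pi_mul eE rq_reprK -{1}qz rq_pi_mul !mulrA.
  rewrite -(subrK (x * rq_repr z * s) 1) -[X in _ + X]opprK.
  apply: (JB); first exact: NJ N1.
  by rewrite -sub0r; apply: (JB) => //; apply/Jr/Jr.
have e1 : e * 1 \notin I by rewrite mulr1; apply: contraNN q0 => /rq_pi_eq0 e0; rewrite -eE e0.
move=> x; rewrite -(Nmax 1 e1); apply/idP/idP => [Ix|].
  by rewrite NE two_sided_mull.
rewrite (Nmax 1 e1) => Mx.
have [s||//] := Ip.2 e x.
  have [es|es] := boolP (e * s \in I); first exact: two_sided_mulr.
  by rewrite -NE Nmax.
by move=> eI; rewrite mulr1 eI in e1.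
Qed.

End PrimeIdeal.

(** * Conductors of a maximal subring *)

Section Conductors.
Variables (T : nzRingType) (R : subringClosed T).
Hypothesis maxR : maximal_subring R.

(** If an R-subbimodule K of T is closed under multiplication, then R + K is a
subring; by maximality it is T as soon as K is not contained in R. *)
Lemma maximal_subring_add (K : T -> Prop) k :
  K 0 -> (forall x y, K x -> K y -> K (x - y)) ->
  (forall x y, K x -> K y -> K (x * y)) ->
  (forall r x, r \in R -> K x -> K (r * x)) ->
  (forall x r, r \in R -> K x -> K (x * r)) ->
  K k -> k \notin R ->
  forall t, exists2 r, r \in R & K (t - r).
Proof.
move=> K0 KB KM Kl Kr Kk Rk.
have KD x y : K x -> K y -> K (x + y).
  by move=> Kx Ky; rewrite -[y]opprK; apply: (KB) => //; rewrite -sub0r; apply: KB.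
have [_ _ /(_ (fun t => `[< exists2 r, r \in R & K (t - r) >]))] := maxR.
case=> [|r Rr|SR|ST t].
- split=> [|x y /asboolP[r Rr Kx] /asboolP[s Rs Ky]|
            x y /asboolP[r Rr Kx] /asboolP[s Rs Ky]]; apply/asboolP.
  + by exists 1; rewrite ?rpred1 // subrr.
  + exists (r - s); first exact: rpredB.
    have -> : x - y - (r - s) = (x - r) - (y - s) by rewrite !opprD !opprK addrACA.
    exact: KB.
  exists (r * s); first exact: rpredM.
  have -> : x * y - r * s = (x - r) * (y - s) + (r * (y - s) + (x - r) * s).
    by rewrite addrA -mulrDl subrK mulrBr mulrBl addrA subrK.
  by apply: (KD); [apply: KM | apply: KD; [apply: Kl | apply: Kr]].
- by apply/asboolP; exists r; rewrite // subrr.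
- case/negP: Rk; rewrite -SR; apply/asboolP.
  by exists 0; rewrite ?rpred0 // subr0.
by apply/asboolP/ST.
Qed.

Lemma conductor_l_prime : prime_ideal (conductor_l_in R).
Proof.
have [_ [z Rz] _] := maxR; split=> [|a b ab].
  by apply: contraNN Rz => /conductor_l_inP/(_ z); rewrite mulr1.
have [|/conductor_l_inP/existsNP[t0 /negP ta]] := boolP (a \in conductor_l_in R); first by left.
right; apply/conductor_l_inP => t.
pose K x := forall t s, s \in R -> t * x * s * val b \in R.
have KR x : K x -> x * val b \in R by move=> /(_ 1 1); rewrite mul1r mulr1; apply; apply: rpred1.
have [||||||r Rr Kr] := @maximal_subring_add K (t0 * val a) _ _ _ _ _ _ ta t.
- by move=> u s _; rewrite mulr0 !mul0r rpred0.
- by move=> x y Kx Ky u s Rs; rewrite mulrBr !mulrBl; apply: rpredB; auto.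
- by move=> x y _ Ky u s Rs; rewrite mulrA; apply: Ky.
- by move=> r x _ Kx u s Rs; rewrite mulrA; apply: Kx.
- by move=> x r Rr Kx u s Rs; rewrite mulrA -[_ * r * s]mulrA; apply: Kx; apply: rpredM.
- move=> u s Rs; have /conductor_l_inP/(_ (u * t0)) := ab (Sub s Rs).
  by rewrite !rmorphM !mulrA.
rewrite -(subrK r t) mulrDl; apply: rpredD; first exact: KR.
by apply: rpredM => //; apply: (valP b).
Qed.

Lemma conductor_r_prime : prime_ideal (conductor_r_in R).
Proof.
have [_ [z Rz] _] := maxR; split=> [|a b ab].
  by apply: contraNN Rz => /conductor_r_inP/(_ z); rewrite mul1r.
have [|/conductor_r_inP/existsNP[t0 /negP tb]] := boolP (b \in conductor_r_in R); first by right.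
left; apply/conductor_r_inP => t.
pose K x := forall s t, s \in R -> val a * s * x * t \in R.
have KR x : K x -> val a * x \in R by move=> /(_ 1 1); rewrite !mulr1; apply; apply: rpred1.
have [||||||r Rr Kr] := @maximal_subring_add K (val b * t0) _ _ _ _ _ _ tb t.
- by move=> s u _; rewrite mulr0 !mul0r rpred0.
- by move=> x y Kx Ky s u Rs; rewrite mulrBr !mulrBl; apply: rpredB; auto.
- by move=> x y Kx _ s u Rs; rewrite mulrA -mulrA; apply: Kx.
- by move=> r x Rr Kx s u Rs; rewrite mulrA -[_ * s * r]mulrA; apply: Kx; apply: rpredM.
- by move=> x r Rr Kx s u Rs; rewrite mulrA -mulrA; apply: Kx.
- move=> s u Rs; have /conductor_r_inP/(_ (t0 * u)) := ab (Sub s Rs).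
  by rewrite !rmorphM !mulrA.
rewrite -(subrK r t) mulrDr; apply: rpredD; first exact: KR.
by apply: rpredM => //; apply: (valP a).
Qed.

End Conductors.

Theorem proposition2p8 (T : nzRingType) (R : subringClosed T)
    (maxR : maximal_subring R) (artR : right_artinian (subring_type R)) :
  (maximal_ideal (conductor_l_in R) /\ maximal_ideal (conductor_r_in R)) /\
  (isotypic_semisimple (right_quot R) /\
   exists N : {pred right_quot R}, maximal_submodule N) /\
  (isotypic_semisimple (left_quot R) /\
   exists N : {pred left_quot R}, maximal_submodule N) /\
  (local_ring (subring_type R) ->
   conductor R =i conductor_l R /\ conductor_l R =i conductor_r R).
Proof.
have Pl : prime_ideal (conductor_l_ideal R) by apply: conductor_l_prime.
have Pr : prime_ideal (conductor_r_ideal R) by apply: conductor_r_prime.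
have [_ [z Rz] _] := maxR.
have z0 : quot_pi R z != 0.
  apply: contraNneq Rz => z0; rewrite -[z]subr0; apply/quot_eqP; rewrite z0.
  by apply: (addrI (quot_pi R 0)); rewrite -quot_piD !addr0.
have [isor maxr] := prime_ideal_right_module (right_quot R) artR Pl.
have [isol maxl] := prime_ideal_left_module (left_quot R) artR Pr.
split; first by split; [apply: (prime_ideal_maximal artR Pl)|apply: (prime_ideal_maximal artR Pr)].
split; first by split; last exact: maxr z0.
split; first by split; last exact: maxl z0.
case=> M _ Muniq.
have lr : conductor_l_in R =i conductor_r_in R.
  move=> x; rewrite (prime_ideal_local artR Pl Muniq).
  by rewrite (prime_ideal_local artR Pr Muniq).
have lT x : x \in conductor_l R -> x \in R.
  by move=> /asboolP/(_ 1); rewrite mul1r.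
have rT x : x \in conductor_r R -> x \in R.
  by move=> /asboolP/(_ 1); rewrite mulr1.
have lrT : conductor_l R =i conductor_r R.
  move=> x; apply/idP/idP => xI.
    exact: etrans (esym (lr (Sub x (lT x xI)))) xI.
  exact: etrans (lr (Sub x (rT x xI))) xI.
split=> // x; apply/asboolP/idP => [xc|xl t u].
  by apply/asboolP => t; rewrite -[_ * x]mulr1.
(* The common ideal is a left ideal of T as (R:T)_l, a right one as (R:T)_r. *)
have: t * x \in conductor_r R.
  rewrite -lrT; apply/asboolP => v; rewrite mulrA; move/asboolP: xl; apply.
by move/asboolP; apply.
Qed.
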